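(* Let $p$ be a homogeneous polynomial on $\mathbb{R}^n$ that is hyperbolic with respect to $e\in\mathbb{R}^n$, and let $\mathcal{F}$ be a face of $\Lambda_+(p,e)$. If $z$ is a point of the relative interior of $\mathcal{F}$ and $m=\operatorname{mult}_p(z)$, then the polynomial $q=\left.D_e^{m}p\right|_{\operatorname{span}(\mathcal{F})}$ on the vector space $\operatorname{span}(\mathcal{F})$ is hyperbolic with respect to $z$, and $\mathcal{F}=\Lambda_+(q,z)$.
   Context: A homogeneous polynomial $p$ of degree $d\ge 0$ on a finite-dimensional real vector space $V$ is hyperbolic with respect to $e\in V$ if $p(e)>0$ and, for each $x\in V$, the univariate polynomial $t\mapsto p(te-x)$ has only real zeros. Its (closed) hyperbolicity cone is $\Lambda_+(p,e)=\{x\in V : \text{all zeros of } t\mapsto p(te-x) \text{ are nonnegative}\}$, which is a closed convex cone. A positive constant polynomial (degree $0$) is hyperbolic with respect to every vector, and its hyperbolicity cone is all of $V$. For $k\ge 0$, $D_e^kp(x)=\frac{d^k}{dt^k}p(x+te)\big|_{t=0}$ is the $k$th directional derivative of $p$ in direction $e$ (with $D_e^0p=p$). For a linear subspace $L\subseteq\mathbb{R}^n$, $\left.f\right|_L$ denotes the restriction of the polynomial $f$ to $L$, regarded as a polynomial on $L$ (so its hyperbolicity cone is a subset of $L\subseteq\mathbb{R}^n$). For $x\in\mathbb{R}^n$, $\operatorname{mult}_p(x)$ denotes the multiplicity of $0$ as a zero of $t\mapsto p(te-x)$ (it is $0$ if $p(x)\neq 0$; it does not depend on the choice of direction of hyperbolicity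 $e$). A face of a closed convex set $C\subseteq\mathbb{R}^n$ is a closed convex set $\mathcal{F}\subseteq C$ such that whenever $x,y\in C$ satisfy $\alpha x+(1-\alpha)y\in\mathcal{F}$ for some $\alpha\in(0,1)$, then $x,y\in\mathcal{F}$. *)

(* Defs.v *)
From mathcomp Require Import all_boot all_order all_algebra.
From mathcomp Require Import boolp classical_sets reals.
From mathcomp Require Import topology convex.
From mathcomp Require Import complex mpoly.

Set Implicit Arguments.
Unset Strict Implicit.
Unset Printing Implicit Defensive.

Import Order.TTheory GRing.Theory Num.Theory.
Import numFieldTopology.Exports.

Local Open Scope classical_set_scope.
Local Open Scope ring_scope.

(* Polynomials on a finite-dimensional real vector space V are represented by
   the functions V -> R they induce, which loses nothing over an infinite field
   and makes restriction to a subspace a composition with its inclusion. *)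
Section Polynomial.
Variables (R : realType) (V : vectType R).
Implicit Types (f : V -> R) (d k : nat) (e a b x : V).

Definition homogeneous_polynomial d f : Prop :=
  exists2 P : {mpoly R[\dim {:V}]}, P \is d.-homog &
    forall x, f x = P.@[fun i => coord (vbasis {:V}) i x].

(* The univariate polynomial t |-> f (t a + b); it is unique, since R is
   infinite, and exists when f is a polynomial (see [line_polyE]). *)
Definition line_poly f a b : {poly R} :=
  xget 0 [set r : {poly R} | forall t, r.[t] = f (t *: a + b)].

Lemma line_polyE d f a b t : homogeneous_polynomial d f ->
  (line_poly f a b).[t] = f (t *: a + b).
Proof.
move=> [P _ fP]; rewrite /line_poly; move: t; case: xgetP => [r _ //|].
set c := fun i => coord (vbasis {:V}) i.
move=> /(_ (mmap polyC (fun i => c i a *: 'X + (c i b)%:P) P)) [] /= t.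
rewrite fP /meval /mmap horner_sum.
apply: eq_bigr => m _; rewrite hornerM hornerC; congr (_ * _).
rewrite /mmap1 horner_prod; apply: eq_bigr => i _.
by rewrite horner_exp !hornerE linearP /= mulrC.
Qed.

Definition real_rooted (r : {poly R}) : Prop :=
  forall w : R[i], root (map_poly (real_complex R) r) w -> complex.Im w = 0.

Definition hyperbolic f e : Prop :=
  [/\ exists d, homogeneous_polynomial d f,
      0 < f e &
      forall x, real_rooted (line_poly f e (- x))].

Definition hyperbolicity_cone f e : set V :=
  [set x | forall t, root (line_poly f e (- x)) t -> 0 <= t].

Definition dirderiv k e f : V -> R := fun x => (line_poly f e x)^`(k).[0].

Definition multiplicity f e x : nat := mup 0 (line_poly f e (- x)).

Definition restriction (L : {vspace V}) f : subvs_of L -> R := f \o vsval.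

(* The least subspace containing a set; its existence is [linear_spanP]. *)
Definition linear_span (F : set V) : {vspace V} :=
  xget 0%VS [set L : {vspace V} | (forall x, F x -> x \in L) /\
    forall M : {vspace V}, (forall x, F x -> x \in M) -> (L <= M)%VS].

Lemma linear_spanP (F : set V) (M : {vspace V}) :
  (linear_span F <= M)%VS <-> (forall x, F x -> x \in M).
Proof.
suff [FL Lmin] : (forall x, F x -> x \in linear_span F) /\
    forall M : {vspace V}, (forall x, F x -> x \in M) ->
      (linear_span F <= M)%VS.
  by split=> [/subvP LM x /FL /LM //|]; exact: Lmin.
rewrite /linear_span; case: xgetP => [L _ //|noL]; exfalso.
have bad n : exists L : {vspace V},
    (forall x, F x -> x \in L) /\ (\dim L + n <= \dim {:V})%N.
  elim: n => [|n [L [FL dL]]].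
    by exists fullv; split=> [x _|]; rewrite ?memvf ?addn0.
  have [N [FN LN]] : exists N : {vspace V},
      (forall x, F x -> x \in N) /\ ~~ (L <= N)%VS.
    apply: contrapT => H; apply: (noL L); split=> // N FN.
    by apply/negPn/negP => LN; apply: H; exists N.
  exists (L :&: N)%VS; split=> [x Fx|]; first by rewrite memv_cap FL ?FN.
  rewrite addnS; apply: leq_trans dL; rewrite ltn_add2r.
  rewrite ltn_neqAle dimvS ?capvSl // andbT.
  apply: contra LN => /eqP dE; apply/capv_idPl/eqP.
  by rewrite eqEdim capvSl dE /=.
have [L [_]] := bad (\dim {:V}).+1.
by rewrite addnS ltnNge leq_addl.
Qed.

End Polynomial.

Arguments restriction {R V} L f _ : assert.

Lemma comp_mpoly_dhomog (R : realType) k l d (P : {mpoly R[k]})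
    (lq : k.-tuple {mpoly R[l]}) :
  P \is d.-homog -> (forall i, tnth lq i \is 1.-homog) -> P \mPo lq \is d.-homog.
Proof.
move=> /dhomogP homP lqP; rewrite comp_mpolyE big_seq.
apply: rpred_sum => m mP; apply: dhomogZ.
have -> : d = (\sum_i m i)%N by rewrite -mdegE -(homP _ mP).
have expP i j : tnth lq i ^+ j \is j.-homog.
  by elim: j => [|j IHj]; [exact: dhomog1|rewrite exprS -add1n dhomogM].
pose K j (q : {mpoly R[l]}) := q \is j.-homog.
apply: (big_ind2 K) => [|j1 q1 j2 q2|i _]; first exact: dhomog1.
  exact: dhomogM.
exact: expP.
Qed.

(* Over 'rV[R]_n the basis [vbasis] may be replaced by the standard one. *)
Lemma homogeneous_polynomial_rV (R : realType) n d (f : 'rV[R]_n -> R) :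
  homogeneous_polynomial d f <->
  exists2 P : {mpoly R[n]}, P \is d.-homog & forall x, f x = P.@[x 0].
Proof.
have hX k (j : 'I_k) : ('X_j : {mpoly R[k]}) \is 1.-homog.
  by rewrite dhomogX; apply/eqP; exact: mdeg1.
split=> -[P homP fP].
  pose lq := [tuple \sum_j coord (vbasis {:'rV[R]_n}) i (delta_mx 0 j) *: 'X_j
               | i < \dim {:'rV[R]_n}] : _.-tuple {mpoly R[n]}.
  exists (P \mPo lq).
    apply: comp_mpoly_dhomog => // i; rewrite tnth_mktuple.
    by apply: rpred_sum => j _; exact: dhomogZ.
  move=> x; rewrite fP comp_mpoly_meval; apply: meval_eq => i.
  rewrite tnth_mktuple raddf_sum /= {1}[x]row_sum_delta linear_sum /=.
  by apply: eq_bigr => j _; rewrite mevalZ mevalXU linearZ /= mulrC.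
pose b := vbasis {:'rV[R]_n}.
pose lq := [tuple \sum_(i < \dim {:'rV[R]_n}) b`_i 0 j *: 'X_i | j < n]
  : _.-tuple {mpoly R[\dim {:'rV[R]_n}]}.
exists (P \mPo lq).
  apply: comp_mpoly_dhomog => // i; rewrite tnth_mktuple.
  by apply: rpred_sum => j _; exact: dhomogZ.
move=> x; rewrite fP comp_mpoly_meval; apply: meval_eq => j.
rewrite tnth_mktuple raddf_sum /= {1}(coord_vbasis (memvf x)) summxE.
by apply: eq_bigr => i _; rewrite mevalZ mevalXU mxE mulrC.
Qed.

Section Convexity.
Variables (R : realType) (n : nat).
Implicit Types (A C F : set 'rV[R]_n).

Definition affine_set A : Prop :=
  forall x y (t : R), A x -> A y -> A (t *: x + (1 - t) *: y).

Definition relative_interior F : set 'rV[R]_n :=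
  [set z | F z /\ within (smallest affine_set F) (nbhs z) F].

Definition face C F : Prop :=
  [/\ closed F, convex_set (F : set (convex_lmodType 'rV[R]_n)), F `<=` C &
      forall x y (t : R), C x -> C y -> 0 < t < 1 ->
        F (t *: x + (1 - t) *: y) -> F x /\ F y].

End Convexity.

(* Main.v *)
Require Import Defs.
From mathcomp Require Import all_boot all_order all_algebra.
From mathcomp Require Import boolp classical_sets reals.
From mathcomp Require Import topology convex.
From mathcomp Require Import complex mpoly zify ring lra.

(* Write [c_j x] for the coefficient of [t ^ j] in [p (t e + x)]; it is
   [D_e^j p x / j!], and the hyperbolicity cone of [p] is the set where all the
   [c_j] are nonnegative. By Gauss-Lucas each [c_j] is hyperbolic with respect
   to [e], with a larger cone. Garding's theorem, proved by a homotopy of roots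
   in the complex plane, then says that a hyperbolic [f] is also hyperbolic
   with respect to every [a] of its cone with [f a != 0], and that
   [f (x + t a) != 0] for [x] in the cone and [t > 0].
   If [j < m] then [c_j] vanishes on the span [L] of the face: for [y] in [F]
   with [c_j y != 0], the point [z - h y] of [F] would give
   [c_j z = c_j ((z - h y) + h y) != 0]. Hence on [L] the cone of [p] is cut
   out by the [c_j] with [m <= j], i.e. it is the cone of [D_e^m p], which may
   be taken with respect to [z] since [c_m z > 0]. Finally [F] is the
   intersection of [L] with the cone of [p], because it is a face. *)

Set Implicit Arguments.
Unset Strict Implicit.
Unset Printing Implicit Defensive.

Import Order.TTheory GRing.Theory Num.Theory.
Import numFieldTopology.Exports.
Import Normc.

Local Open Scope classical_set_scope.
Local Open Scope ring_scope.

(** * Roots of complex polynomials *)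

Section ComplexRoots.
Variable R : realType.
Local Notation C := R[i].
Local Notation toC := (real_complex R).
Implicit Types (p : {poly C}) (s : seq C) (z w t : C).

Lemma normc_ge0 z : 0 <= normc z.
Proof. by case: z => a b; rewrite sqrtr_ge0. Qed.

Lemma normc_real (x : R) : normc (toC x) = `|x|.
Proof. by rewrite /= expr0n addr0 sqrtr_sqr. Qed.

Lemma normc_ge_Im z : `|complex.Im z| <= normc z.
Proof.
case: z => a b /=; rewrite -sqrtr_sqr ler_sqrt ?addr_ge0 ?sqr_ge0 //.
by rewrite lerDr sqr_ge0.
Qed.

Lemma normcX z k : normc (z ^+ k) = normc z ^+ k.
Proof.
elim: k => [|k IH]; first by rewrite !expr0 normc1.
by rewrite !exprS normcM IH.
Qed.

Lemma normc_sum (I : Type) (r : seq I) (F : I -> C) :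
  normc (\sum_(i <- r) F i) <= \sum_(i <- r) normc (F i).
Proof.
elim: r => [|i r IH]; first by rewrite !big_nil normc0.
by rewrite !big_cons (le_trans (le_normcD _ _)) // lerD2l.
Qed.

Lemma normc_prod_ge (h : R) s w : 0 <= h -> (forall t, t \in s -> h <= normc (w - t)) ->
  h ^+ size s <= normc (\prod_(t <- s) (w - t)).
Proof.
move=> h0; elim: s => [|t s IH] H /=; first by rewrite big_nil expr0 normc1.
rewrite big_cons normcM exprS ler_pM ?exprn_ge0 //; first by rewrite H ?mem_head.
by apply: IH => u us; rewrite H // in_cons us orbT.
Qed.

(** The modulus of p(w) is that of the leading coefficient times the product of the distances from w
    to the roots, so these distances cannot all be at least h. *)
Lemma root_near p (h : R) w : 0 <= h ->
  normc p.[w] < normc (lead_coef p) * h ^+ (size p).-1 ->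
  exists2 t, root p t & normc (w - t) < h.
Proof.
move=> h0; have [r pE] := closed_field_poly_normal p.
have [->|p0] := eqVneq p 0; first by rewrite lead_coef0 horner0 normc0 mul0r ltxx.
have sp : (size p).-1 = size r.
  by rewrite pE size_scale ?lead_coef_eq0 // size_prod_XsubC.
move=> lt_pw; apply: contrapT => nex.
move: lt_pw; rewrite ltNge => /negP; apply; rewrite sp.
rewrite [in leRHS]pE hornerZ normcM ler_wpM2l ?normc_ge0 //.
rewrite horner_prod; under eq_bigr do rewrite hornerXsubC.
apply: normc_prod_ge => // t tr; rewrite leNgt; apply/negP => tw; apply: nex.
exists t => //; rewrite pE rootZ ?lead_coef_eq0 // root_prod_XsubC //.
Qed.

(** Cauchy's bound: if |w| > 1, isolate the top term in p(w) = 0 and bound each lower power of w by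
    |w|^d, where d + 1 is the degree. *)
Lemma root_normc_le p w : p != 0 -> root p w ->
  normc w <= 1 + (\sum_(j < (size p).-1) normc p`_j) / normc (lead_coef p).
Proof.
move=> p0 pw; set S := \sum_(_ < _) _.
have S0 : 0 <= S by apply: sumr_ge0 => j _; exact: normc_ge0.
have l0 : 0 < normc (lead_coef p).
  rewrite lt_neqAle normc_ge0 andbT eq_sym; apply: contra p0 => /eqP/eq0_normc/eqP.
  by rewrite lead_coef_eq0.
have [w1|w1] := leP (normc w) 1.
  by rewrite (le_trans w1) // lerDl divr_ge0 ?normc_ge0.
suff : normc w <= S / normc (lead_coef p).
  by move=> /le_trans; apply; rewrite lerDr.
rewrite ler_pdivlMr //.
move: pw; rewrite /root horner_coef; have /prednK <- : (0 < size p)%N.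
  by rewrite size_poly_gt0.
rewrite big_ord_recr /= -/(lead_coef p) addrC addr_eq0 => /eqP H.
have w0 : 0 < normc w by rewrite (lt_trans ltr01).
case E: (size p).-1 => [|d].
  move: H; rewrite E big_ord0 oppr0 expr0 mulr1 => /eqP.
  by rewrite lead_coef_eq0 (negbTE p0).
have := congr1 (@normc R) H; rewrite normcN normcM normcX E exprS => {}H.
rewrite -(@ler_pM2r _ (normc w ^+ d)) ?exprn_gt0 //.
rewrite -mulrA mulrCA H -/(lead_coef p).
apply: le_trans (normc_sum _ _) _; rewrite /S E mulr_suml.
apply: ler_sum => j _; rewrite normcM normcX ler_wpM2l ?normc_ge0 //.
by rewrite ler_weXn2l ?(ltW w1) // -ltnS.
Qed.

End ComplexRoots.

(** * Continuity of roots in a one-parameter family *)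

Section Homotopy.
Variable R : realType.
Local Notation C := R[i].
Local Notation toC := (real_complex R).

(** Connectedness of [0, 1]: local constancy carries [P] to the supremum of the parameters where it
    holds, and beyond it if the supremum is less than 1. *)
Lemma locally_constant_itv01 (P : R -> Prop) : P 0 ->
  (forall s, 0 <= s <= 1 -> exists2 h, 0 < h &
     forall s', 0 <= s' <= 1 -> `|s' - s| < h -> P s <-> P s') ->
  P 1.
Proof.
move=> P0 Ploc; pose E := [set s | 0 <= s <= 1 /\ P s].
have E0 : E 0 by split=> //; rewrite lexx ler01.
have ubE : ubound E 1 by move=> s [/andP[]].
have supE : has_sup E by split; [exists 0|exists 1].
have s01 : 0 <= sup E <= 1.
  by rewrite ge_sup //; [rewrite andbT; apply: ub_le_sup => //; exists 1|exists 0].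
have [h h0 hP] := Ploc _ s01.
have [s [s01' Ps] lt_s] := sup_adherent h0 supE.
have s_sup : s <= sup E by apply: ub_le_sup => //; exists 1.
have Psup : P (sup E) by apply/(hP s) => //; rewrite ler0_norm ?subr_le0 //; lra.
have [sup1|sup1] := leP 1 (sup E).
  by rewrite -(_ : sup E = 1) //; apply/eqP; rewrite eq_le sup1; case/andP: s01 => _ ->.
pose s' := Num.min 1 (sup E + h / 2).
have s'sup : sup E < s' by rewrite lt_min sup1 /=; lra.
have s'01 : 0 <= s' <= 1 by rewrite ge_min lexx andbT; case/andP: s01 => *; lra.
have s'h : s' <= sup E + h / 2 by rewrite ge_min lexx orbT.
have : E s'.
  by split=> //; apply/(hP s') => //; rewrite ger0_norm ?subr_ge0; lra.
move=> Es'; suff : s' <= sup E by move=> ?; lra.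
by apply: ub_le_sup => //; exists 1.
Qed.

Lemma normc_horner_le (p : {poly C}) (w : C) (B : R) : normc w <= B ->
  normc p.[w] <= \sum_(j < size p) normc p`_j * B ^+ j.
Proof.
move=> wB; rewrite horner_coef; apply: le_trans (normc_sum _ _) _.
apply: ler_sum => j _; rewrite normcM normcX ler_wpM2l ?normc_ge0 //.
have B0 : 0 <= B := le_trans (normc_ge0 w) wB.
by rewrite lerXn2r ?nnegrE ?normc_ge0.
Qed.

Lemma lipschitz_expr01 (s t : R) k : 0 <= s <= 1 -> 0 <= t <= 1 ->
  `|s ^+ k - t ^+ k| <= k%:R * `|s - t|.
Proof.
move=> /andP[s0 s1] /andP[t0 t1].
elim: k => [|k IH]; first by rewrite !expr0 subrr normr0 mul0r.
rewrite !exprS (_ : _ - _ = s * (s ^+ k - t ^+ k) + (s - t) * t ^+ k); last by ring.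
rewrite -natr1 [leRHS]mulrDl mul1r (le_trans (ler_normD _ _)) // !normrM.
apply: lerD.
  by rewrite (le_trans _ IH) // ler_piMl // ger0_norm.
by rewrite ler_piMr // normrX exprn_ile1 // ger0_norm.
Qed.

(** The outer variable is the homotopy parameter; the inner one is the variable whose roots are
    followed. *)
Variable Q : {poly {poly C}}.
Local Notation G s := Q.[(toC s)%:P].

Lemma family_coef_bound j : exists B, forall s, 0 <= s <= 1 -> normc (G s)`_j <= B.
Proof.
exists (\sum_(k < size Q) normc (Q`_k)`_j) => s /andP[s0 s1].
rewrite horner_coef coef_sum; apply: le_trans (normc_sum _ _) _.
apply: ler_sum => k _; rewrite -polyC_exp coefMC normcM -rmorphXn normc_real.
by rewrite ler_piMr ?normc_ge0 // normrX exprn_ile1 // ger0_norm.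
Qed.

(** On a disc containing all the roots, this bounds the value of [G t] at a root of [G s] by a
    multiple of |s - t|, as [root_near] requires. *)
Lemma family_lipschitz (B : R) : exists2 K, 0 <= K &
  forall s t w, 0 <= s <= 1 -> 0 <= t <= 1 -> normc w <= B ->
    normc ((G s).[w] - (G t).[w]) <= K * `|s - t|.
Proof.
pose M k := \sum_(j < size Q`_k) normc (Q`_k)`_j * `|B| ^+ j.
have M0 k : 0 <= M k.
  by apply: sumr_ge0 => j _; rewrite mulr_ge0 ?normc_ge0 ?exprn_ge0.
exists (\sum_(k < size Q) M k * k%:R).
  by apply: sumr_ge0 => k _; rewrite mulr_ge0.
move=> s t w s01 t01 wB; rewrite !(horner_coef Q) !horner_sum -sumrB mulr_suml.
apply: le_trans (normc_sum _ _) _; apply: ler_sum => k _.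
have evalE x : (Q`_k * (toC x)%:P ^+ k).[w] = (Q`_k).[w] * toC (x ^+ k).
  by rewrite hornerM horner_exp hornerC rmorphXn.
rewrite 2!evalE -mulrBr -rmorphB.
rewrite normcM normc_real -mulrA ler_pM ?normc_ge0 ?lipschitz_expr01 //.
by apply: normc_horner_le; rewrite (le_trans wB) // ler_norm.
Qed.

(** With the degree and the leading coefficient independent of the parameter, no root escapes to
    infinity. *)
Variables (d : nat) (c : C).
Hypothesis c0 : c != 0.
Hypothesis sizeG : forall s, (size (G s) <= d.+1)%N.
Hypothesis leadG : forall s, (G s)`_d = c.

Let sizeG' s : size (G s) = d.+1.
Proof.
apply/eqP; rewrite eqn_leq sizeG ltnNge; apply/negP => le_sd.
by move: (leadG s); rewrite nth_default // => /esym/eqP; rewrite (negbTE c0).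
Qed.

Let lead_coefG s : lead_coef (G s) = c.
Proof. by rewrite lead_coefE sizeG' leadG. Qed.

Lemma family_root_bound : exists B, forall s w,
  0 <= s <= 1 -> root (G s) w -> normc w <= B.
Proof.
have [b bP] := choice family_coef_bound.
exists (1 + (\sum_(j < d) b j) / normc c) => s w s01 /root_normc_le.
rewrite -size_poly_gt0 sizeG' lead_coefG => /(_ isT)/le_trans; apply.
rewrite lerD2l ler_wpM2r ?invr_ge0 ?normc_ge0 // ler_sum // => j _.
exact: bP.
Qed.

Lemma Im_gap (p : {poly C}) : p != 0 -> (forall w, root p w -> complex.Im w != 0) ->
  exists2 h, 0 < h & forall w, root p w -> h <= `|complex.Im w|.
Proof.
move=> p0 H; have [r pE] := closed_field_poly_normal p.
have rP w : root p w = (w \in r).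
  by rewrite pE rootZ ?lead_coef_eq0 // root_prod_XsubC.
have {}H : forall w, w \in r -> complex.Im w != 0 by move=> w; rewrite -rP; exact: H.
suff [h h0 hP] : exists2 h, 0 < h & forall w, w \in r -> h <= `|complex.Im w|.
  by exists h => // w; rewrite rP; exact: hP.
elim: r H {pE rP} => [|t r IH] H; first by exists 1.
have [w wr|h h0 hP] := IH; first by rewrite H // in_cons wr orbT.
have t0 : complex.Im t != 0 by rewrite H ?mem_head.
exists (Num.min h `|complex.Im t|); first by rewrite lt_min h0 normr_gt0.
by move=> w /predU1P[->|/hP hw]; rewrite ge_min ?lexx ?hw ?orbT.
Qed.

(* No root crosses the real axis, and roots move continuously, hence the roots
   stay in the lower half-plane. *)
Lemma lower_half_plane_homotopy :
  (forall s w, 0 <= s <= 1 -> root (G s) w -> complex.Im w != 0) ->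
  (forall w, root (G 0) w -> complex.Im w < 0) ->
  forall w, root (G 1) w -> complex.Im w < 0.
Proof.
move=> Greal; pose P s := forall w, root (G s) w -> complex.Im w < 0.
move=> P0; suff: P 1 by []; apply: locally_constant_itv01 => // s s01.
have G0 t : G t != 0 by rewrite -size_poly_gt0 sizeG'.
have [h h0 hP] := Im_gap (G0 s) (Greal s ^~ s01).
have [B BP] := family_root_bound.
have [K K0 KP] := family_lipschitz B.
have cpos : 0 < normc c.
  by rewrite lt_neqAle normc_ge0 andbT eq_sym; apply: contra c0 => /eqP/eq0_normc ->.
have ch : 0 < normc c * h ^+ d by rewrite mulr_gt0 ?exprn_gt0.
(* At a root w of [G s1] the value of [G s2] is at most K |s1 - s2|, so [root_near] finds a root of
   [G s2] at distance less than h from w. *)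
have near_root s1 s2 w : 0 <= s1 <= 1 -> 0 <= s2 <= 1 ->
    (K + 1) * `|s1 - s2| < normc c * h ^+ d -> root (G s1) w ->
    exists2 t, root (G s2) t & `|complex.Im w - complex.Im t| < h.
  move=> s1P s2P lt_s rw.
  have [|t rt lt_t] := @root_near _ (G s2) h w (ltW h0); last first.
    exists t => //; apply: le_lt_trans lt_t; rewrite -raddfB /=.
    exact: normc_ge_Im.
  rewrite lead_coefG sizeG' /= -normcN -[- _]add0r -(rootP rw).
  apply: le_lt_trans (KP _ _ _ s1P s2P (BP _ _ s1P rw)) _.
  by apply: le_lt_trans lt_s; rewrite ler_wpM2r // lerDl.
(* Dividing by K + 1 instead of K covers the case K = 0. *)
exists (normc c * h ^+ d / (K + 1)); first by rewrite divr_gt0 // ltr_wpDl.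
have K1 : 0 < K + 1 by lra.
move=> s' s'01; rewrite (ltr_pdivlMr _ _ K1) mulrC => lt_s.
(* The roots of [G s] are at distance at least h from the real axis, so a root of [G s'] matched to
   one of them, or conversely, lies on the same side. *)
split=> [Ps w rw|Ps' w rw].
  have [t rt] := near_root _ _ _ s'01 s01 lt_s rw.
  have := hP _ rt; rewrite (ltr0_norm (Ps _ rt)) ltr_norml => ht /andP[? ?].
  lra.
rewrite distrC in lt_s.
have [t rt] := near_root _ _ _ s01 s'01 lt_s rw.
move=> lt_t; have t0 := Ps' _ rt; move: lt_t; rewrite ltr_norml => /andP[? ?].
rewrite ltNge; apply/negP => w0; have := hP _ rw; rewrite ger0_norm // => ?.
lra.
Qed.

End Homotopy.

(** * Evaluation along lines *)

Section LineMmap.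
Variables (N : nat) (R A : comNzRingType) (phi : {rmorphism R -> A}).
Implicit Types (P : {mpoly R[N]}) (a b h : 'I_N -> A) (d : nat).

Lemma rmorph_mmap (B : comNzRingType) (psi : {rmorphism A -> B}) h P :
  psi (mmap phi h P) = mmap (psi \o phi) (psi \o h) P.
Proof.
rewrite /mmap rmorph_sum; apply: eq_bigr => m _; rewrite rmorphM; congr (_ * _).
by rewrite /mmap1 rmorph_prod; apply: eq_bigr => i _; rewrite rmorphXn.
Qed.

Lemma mmap_dhomogZ d P h (l : A) : P \is d.-homog ->
  mmap phi (fun i => l * h i) P = l ^+ d * mmap phi h P.
Proof.
move=> /dhomogP homP; rewrite /mmap big_distrr /= big_seq [RHS]big_seq.
apply: eq_bigr => m /homP mP; rewrite mulrCA; congr (_ * _).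
rewrite /mmap1 -[in RHS]mP /= mdegE expr_sum -big_split.
by apply: eq_bigr => i _; rewrite exprMn.
Qed.

(** A formal version of [line_poly] over any commutative ring: [A] will be the reals, the complex
    numbers, a ring of univariate polynomials (for homotopies) and one of multivariate polynomials
    (for derivatives). *)
Definition line_mmap a b P : {poly A} :=
  mmap (polyC \o phi) (fun i => a i *: 'X + (b i)%:P) P.

Lemma horner_line_mmap a b P t :
  (line_mmap a b P).[t] = mmap phi (fun i => t * a i + b i) P.
Proof.
rewrite /line_mmap /mmap horner_sum.
apply: eq_bigr => m _; rewrite hornerM hornerC; congr (_ * _).
rewrite /mmap1 horner_prod; apply: eq_bigr => i _.
by rewrite horner_exp !hornerE mulrC.
Qed.

Lemma coefM_top j k (p q : {poly A}) :
  (size p <= j.+1)%N -> (size q <= k.+1)%N -> (p * q)`_(j + k) = p`_j * q`_k.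
Proof.
move=> sp sq; rewrite coefM (bigD1 (inord j : 'I_(j + k).+1)) //= inordK ?ltnS ?leq_addr //.
rewrite addKn big1 ?addr0 // => i ij; have [lt_ij|] := ltnP i j.
  by rewrite [q`_ _]nth_default ?mulr0 // (leq_trans sq) // ltn_subRL ltn_add2r.
rewrite leq_eqVlt => /predU1P[ji|ji]; last first.
  by rewrite nth_default ?mul0r // (leq_trans sp).
by case/eqP: ij; apply/val_inj; rewrite /= inordK ?ltnS ?leq_addr.
Qed.

(** Each factor a_i X + b_i has degree at most 1 with coefficient a_i at X. The relation [K] tracks
    a degree bound together with the coefficient at that degree, and is compatible with products. *)
Lemma line_mmap_dhomog d P a b : P \is d.-homog ->
  (size (line_mmap a b P) <= d.+1)%N /\ (line_mmap a b P)`_d = mmap phi a P.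
Proof.
move=> /dhomogP homP; pose K j (q : {poly A}) v := (size q <= j.+1)%N /\ q`_j = v.
have KM j1 q1 v1 j2 q2 v2 : K j1 q1 v1 -> K j2 q2 v2 ->
    K (j1 + j2)%N (q1 * q2) (v1 * v2).
  move=> [s1 <-] [s2 <-]; split; last exact: coefM_top.
  apply: leq_trans (size_polyMleq _ _) _.
  by rewrite -subn1 leq_subLR add1n -addnS -addSn leq_add.
have KX i j : K j ((a i *: 'X + (b i)%:P) ^+ j) (a i ^+ j).
  elim: j => [|j IH]; first by rewrite /K !expr0 coefC size_poly1.
  rewrite !exprS -add1n; apply: KM IH; split.
    rewrite (leq_trans (size_polyD _ _)) // geq_max.
    rewrite (leq_trans (size_scale_leq _ _)) ?size_polyX //.
    by rewrite (leq_trans (size_polyC_leq1 _)).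
  by rewrite coefD coefZ coefX coefC mulr1 addr0.
suff : K d (line_mmap a b P) (mmap phi a P) by [].
rewrite /line_mmap /mmap big_seq [X in K _ _ X]big_seq.
apply: (big_ind2 (K d)) => [|q1 v1 q2 v2 [s1 <-] [s2 <-]|m mP].
- by rewrite /K size_poly0 coef0.
- by rewrite /K coefD (leq_trans (size_polyD _ _)) // geq_max s1.
rewrite -[d]add0n; apply: (KM); first by rewrite /K /= coefC size_polyC_leq1.
rewrite -(homP _ mP) /= mdegE /mmap1.
apply: (big_ind3 K) => [|j1 q1 v1 j2 q2 v2 K1 K2|i _]; last exact: KX.
  by rewrite /K size_poly1 coefC.
exact: KM.
Qed.

End LineMmap.

(** * Complex zeros along a homotopy of points *)

Section ComplexEvaluation.
Variables (R : realType) (N d : nat) (P : {mpoly R[N]}).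
Hypothesis homP : P \is d.-homog.
Local Notation C := R[i].
Local Notation toC := (real_complex R).
Local Notation FC h := (mmap toC h P).

(** The homotopy is w |-> P(w A + E + s B) for s in [0, 1]; by homogeneity its leading coefficient
    in w is P(A), whatever s is. *)
Lemma mmap_lower_half_plane (E A B : 'I_N -> C) : FC A != 0 ->
  (forall s t : R, 0 <= s <= 1 ->
     FC (fun i => toC t * A i + (E i + toC s * B i)) != 0) ->
  (forall w, FC (fun i => w * A i + E i) = 0 -> complex.Im w < 0) ->
  forall w, FC (fun i => w * A i + (E i + B i)) = 0 -> complex.Im w < 0.
Proof.
move=> A0 noreal start w end0.
pose Q := line_mmap (polyC \o toC) (fun i => (B i)%:P)
  (fun i => A i *: 'X + (E i)%:P) P.
have QE s : Q.[(toC s)%:P] = line_mmap toC A (fun i => E i + toC s * B i) P.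
  rewrite horner_line_mmap; congr mmap; apply/funext => i.
  by rewrite rmorphD rmorphM /= addrC -addrA.
have H s := line_mmap_dhomog toC A (fun i => E i + toC s * B i) homP.
apply: (@lower_half_plane_homotopy _ Q d (FC A)) => //.
- by move=> s; rewrite QE; case: (H s).
- by move=> s; rewrite QE; case: (H s).
- move=> s v s01; rewrite QE => rv; apply/eqP => v0.
  move: rv; rewrite /root horner_line_mmap.
  by have := noreal s (complex.Re v) s01; case: v v0 => x y /= -> /negbTE ->.
- move=> v; rewrite QE /root horner_line_mmap => /eqP v0; apply: start.
  rewrite -[RHS]v0; congr mmap; apply/funext => i.
  by rewrite rmorph0 mul0r addr0.
rewrite QE /root horner_line_mmap -[X in _ == X]end0; apply/eqP.
by congr mmap; apply/funext => i; rewrite rmorph1 mul1r.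
Qed.

Lemma mmap_conjc (h : 'I_N -> C) : FC (fun i => conjc (h i)) = conjc (FC h).
Proof.
rewrite (rmorph_mmap toC (conjc : {rmorphism C -> C})); congr mmap.
by apply/funext => x /=; rewrite oppr0.
Qed.

End ComplexEvaluation.

(** * Homogeneous polynomials along real lines *)

Lemma poly_eq_horner (R : realFieldType) (p q : {poly R}) :
  (forall t, p.[t] = q.[t]) -> p = q.
Proof.
move=> pq; apply/eqP; rewrite -subr_eq0; apply/negPn/negP => pq0.
have := @max_poly_roots _ _ [seq i%:R | i <- iota 0 (size (p - q))] pq0.
rewrite size_map size_iota ltnn map_inj_uniq ?iota_uniq; last exact: (mulrIn (oner_neq0 R)).
move=> H; suff: false by [].
by apply: H => //; apply/allP => x _; rewrite /root !hornerE pq subrr.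
Qed.

Lemma line_polyP (R : realType) (V : vectType R) (f : V -> R) a b (r : {poly R}) :
  (forall t, r.[t] = f (t *: a + b)) -> line_poly f a b = r.
Proof.
move=> rP; rewrite /line_poly; case: xgetP => [q _ qP|/(_ r)] //=.
by apply: poly_eq_horner => t; rewrite qP rP.
Qed.

Section HomogeneousPolynomial.
Variables (R : realType) (V : vectType R) (d : nat) (f : V -> R).
Hypothesis homf : homogeneous_polynomial d f.
Implicit Types (a b e x : V) (t : R).

Lemma homogeneousZ t x : f (t *: x) = t ^+ d * f x.
Proof.
have [P homP fP] := homf; rewrite !fP -(mmap_dhomogZ _ _ t homP).
by congr mmap; apply/funext => i; rewrite linearZ.
Qed.

Lemma homogeneousN x : f (- x) = (- 1) ^+ d * f x.
Proof. by rewrite -scaleN1r homogeneousZ. Qed.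

Lemma homogeneousN_eq0 x : (f (- x) == 0) = (f x == 0).
Proof. by rewrite homogeneousN mulf_eq0 signr_eq0. Qed.

Lemma homogeneousZ_eq0 t x : t != 0 -> (f (t *: x) == 0) = (f x == 0).
Proof. by move=> t0; rewrite homogeneousZ mulf_eq0 expf_eq0 (negbTE t0) andbF. Qed.

Lemma line_poly_size_top a b :
  (size (line_poly f a b) <= d.+1)%N /\ (line_poly f a b)`_d = f a.
Proof.
have [P homP fP] := homf; pose c x := coord (vbasis {:V}) ^~ x.
have -> : line_poly f a b = line_mmap idfun (c a) (c b) P.
  apply: line_polyP => t; rewrite horner_line_mmap fP; congr mmap.
  by apply/funext => i; rewrite linearP.
by rewrite fP; apply: line_mmap_dhomog.
Qed.

End HomogeneousPolynomial.

(** * Garding's theorem *)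

Section RealRooted.
Variable R : realType.
Implicit Types (r : {poly R}) (s : seq R).

(** Over the complex numbers the polynomial splits; its roots being real, their real parts give the
    factorization over the reals. *)
Lemma real_rooted_split r : real_rooted r ->
  exists s, r = lead_coef r *: \prod_(t <- s) ('X - t%:P).
Proof.
move=> rr; have [->|r0] := eqVneq r 0; first by exists [::]; rewrite lead_coef0 scale0r.
have [u uE] := closed_field_poly_normal (map_poly (real_complex R) r).
have r'0 : lead_coef (map_poly (real_complex R) r) != 0.
  by rewrite lead_coef_eq0 map_poly_eq0.
exists [seq complex.Re w | w <- u]; apply: (map_poly_inj (real_complex R)).
rewrite map_polyZ rmorph_prod [LHS]uE lead_coef_map big_map; congr (_ *: _).
rewrite big_seq [RHS]big_seq; apply: eq_bigr => w wu.
have := rr w; rewrite uE rootZ // root_prod_XsubC wu => /(_ isT).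
by case: w {wu} => x y /= ->; rewrite rmorphB /= map_polyX map_polyC.
Qed.

Lemma positive_roots_gap r : r != 0 -> real_rooted r ->
  (forall t, root r t -> 0 < t) ->
  exists2 h, 0 < h & forall t, root r t -> h < t.
Proof.
move=> r0 /real_rooted_split[s sE].
have rP t : root r t = (t \in s).
  by rewrite sE rootZ ?lead_coef_eq0 // root_prod_XsubC.
move=> H; have {}H : forall t, t \in s -> 0 < t by move=> t; rewrite -rP; exact: H.
suff [h h0 hs] : exists2 h, 0 < h & forall t, t \in s -> h < t.
  by exists h => // t; rewrite rP; exact: hs.
elim: s H {sE rP} => [|t s IH] H; first by exists 1.
have [u us|h h0 hs] := IH; first by rewrite H // in_cons us orbT.
have t0 : 0 < t by rewrite H ?mem_head.
exists (Num.min h (t / 2)); first by rewrite lt_min h0 divr_gt0.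
move=> u /predU1P[->|/hs hu]; rewrite gt_min ?hu //.
by rewrite ltr_pdivrMr // ltr_pMr ?ltr1n ?orbT.
Qed.

End RealRooted.

Section Garding.
Variables (R : realType) (V : vectType R) (d : nat) (f : V -> R) (e : V).
Variable P : {mpoly R[\dim {:V}]}.
Hypothesis homP : P \is d.-homog.
Hypothesis fP : forall x, f x = P.@[fun i => coord (vbasis {:V}) i x].
Hypothesis fe0 : f e != 0.
Hypothesis rre : forall x, real_rooted (line_poly f e (- x)).
Local Notation C := R[i].
Local Notation toC := (real_complex R).
Local Notation FC h := (mmap toC h P).
Implicit Types (a b x y : V) (w : C) (t : R).

Let homf : homogeneous_polynomial d f. Proof. by exists P. Qed.

(** Real points are embedded by their coordinates, so that [FC] extends [f] to the complexification
    of [V]. *)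
Let iota x : 'I_(\dim {:V}) -> C := fun i => toC (coord (vbasis {:V}) i x).

Let iotaD x y i : iota (x + y) i = iota x i + iota y i.
Proof. by rewrite /iota linearD rmorphD. Qed.

Let iotaN x i : iota (- x) i = - iota x i.
Proof. by rewrite /iota linearN rmorphN. Qed.

Let iotaZ t x i : iota (t *: x) i = toC t * iota x i.
Proof. by rewrite /iota linearZ /= rmorphM. Qed.

Let FC_real x : FC (iota x) = toC (f x).
Proof. by rewrite fP (rmorph_mmap idfun). Qed.

Let FC_eq0 x : (FC (iota x) == 0) = (f x == 0).
Proof. by rewrite FC_real fmorph_eq0. Qed.

Let line_poly_complex a b w :
  (map_poly toC (line_poly f a b)).[w] = FC (fun i => w * iota a i + iota b i).
Proof.
rewrite -horner_line_mmap.
pose c x i := coord (vbasis {:V}) i x.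
have -> : line_poly f a b = line_mmap idfun (c a) (c b) P.
  apply: line_polyP => t; rewrite horner_line_mmap fP; congr mmap.
  by apply/funext => i; rewrite /c linearP.
congr _.[w]; rewrite /line_mmap (rmorph_mmap _ (map_poly toC)).
rewrite (_ : map_poly toC \o (polyC \o idfun) = polyC \o toC); last first.
  by apply/funext => x /=; rewrite map_polyC.
congr mmap; apply/funext => i /=.
by rewrite rmorphD /= map_polyC map_polyZ map_polyX.
Qed.

Let eq0_real_multiple x w : FC (fun i => w * iota e i + iota x i) = 0 -> complex.Im w = 0.
Proof.
move=> H; apply: (rre (x := - x)).
by rewrite opprK /root line_poly_complex H.
Qed.

(* [strict a] says that [a] lies in the interior of the hyperbolicity cone. *)
Let strict a := forall t, f (t *: e - a) = 0 -> 0 < t.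

Let strict_neq0 a : strict a -> f a != 0.
Proof.
move=> sa; apply/eqP => a0; have := sa 0; rewrite scale0r add0r ltxx.
by move=> H; suff: false by []; apply: H; apply/eqP; rewrite (homogeneousN_eq0 homf) a0.
Qed.

(** The roots of t |-> f(t e - a) are finitely many and positive, and subtracting h e from a lowers
    them all by h. *)
Let strict_shift a : strict a -> exists2 h, 0 < h & strict (a - h *: e).
Proof.
move=> sa; have lpE t : root (line_poly f e (- a)) t = (f (t *: e - a) == 0).
  by rewrite /root (line_polyE _ _ _ homf).
have [| |t|h h0 hP] := @positive_roots_gap _ (line_poly f e (- a)).
- apply/eqP => l0; have [_] := line_poly_size_top homf e (- a).
  by rewrite l0 coef0 => /esym/eqP; rewrite (negbTE fe0).
- exact: rre.
- by rewrite lpE => /eqP/sa.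
exists h => // t; rewrite opprB addrA -scalerDl => H.
by have := hP (t + h); rewrite lpE H eqxx => /(_ isT); rewrite ltrDr.
Qed.

Let complexZ_eq0 w (h : 'I_(\dim {:V}) -> C) : w != 0 ->
  FC (fun i => w * h i) = 0 -> FC h = 0.
Proof.
move=> w0; rewrite (mmap_dhomogZ toC h w homP) => /eqP.
by rewrite mulf_eq0 expf_eq0 (negbTE w0) andbF => /eqP.
Qed.

Let complex_realE w : complex.Im w = 0 -> w = toC (complex.Re w).
Proof. by case: w => x y /= ->. Qed.

(** Move s x from 0 to x in f(w a + i h e + s x). A real zero w would make i h a zero of a real line
    in direction e, contradicting hyperbolicity; at s = 0 the zeros can be computed from those of
    f(t e - a). *)
Let strict_lower a x (h : R) : strict a -> 0 < h -> forall w,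
  FC (fun i => w * iota a i + (toC h * 'i%C * iota e i + iota x i)) = 0 ->
  complex.Im w < 0.
Proof.
move=> sa h0.
have hi0 : toC h * 'i%C != 0.
  by rewrite -[_ * _]/(Complex _ _) eq_complex /= !mulr0 !mul0r mulr1 !addr0 (gt_eqF h0) andbF.
apply: (@mmap_lower_half_plane R _ d P homP
  (fun i => toC h * 'i%C * iota e i) (iota a) (iota x)).
- by rewrite FC_eq0 strict_neq0.
- move=> s t _; apply/eqP => H.
  suff : complex.Im (toC h * 'i%C) = 0.
    by rewrite /= mul0r mulr1 addr0 => /eqP; rewrite gt_eqF.
  apply: (@eq0_real_multiple (t *: a + s *: x)).
  rewrite -[RHS]H; congr mmap; apply/funext => i.
  by rewrite iotaD !iotaZ; ring.
- move=> w H; have w0 : w != 0.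
    apply/eqP => w0; suff : FC (iota e) = 0.
      by move/eqP; rewrite FC_eq0 (negbTE fe0).
    apply: (complexZ_eq0 hi0); rewrite -[RHS]H; congr mmap; apply/funext => i.
    by rewrite w0; ring.
  (* Homogeneity turns a zero w of f(w a + i h e) into the zero v of f(v e - a), which is real and
     positive; hence w = - i h / v. *)
  pose v := - (toC h * 'i%C) / w.
  have vE : FC (fun i => v * iota e i + iota (- a) i) = 0.
    apply: (@complexZ_eq0 (- w)); first by rewrite oppr_eq0.
    rewrite -[RHS]H; congr mmap; apply/funext => i.
    by rewrite iotaN /v; field.
  have /complex_realE vr := eq0_real_multiple vE.
  set t := complex.Re v in vr.
  have t0 : 0 < t.
    apply: sa; apply/eqP; rewrite -FC_eq0 -[X in _ == X]vE.
    by apply/eqP; congr mmap; apply/funext => i; rewrite vr /iota linearP /= rmorphD rmorphM.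
  have -> : w = toC (- (h / t)) * 'i%C.
    have t0' : toC t != 0 by rewrite fmorph_eq0 gt_eqF.
    apply: (mulfI t0'); rewrite -{1}vr /v mulfVK // rmorphN fmorph_div /=.
    by field.
  by rewrite /= mul0r mulr1 addr0 oppr_lt0 divr_gt0.
Qed.

(* Replacing [a] by [a - h e] frees an imaginary multiple of [e], so that
   [strict_lower] applies without passing to the limit [h = 0]. *)
Let strict_real a x w : strict a ->
  FC (fun i => w * iota a i + iota x i) = 0 -> complex.Im w = 0.
Proof.
move=> sa.
have pos v : FC (fun i => v * iota a i + iota x i) = 0 -> complex.Im v <= 0.
  move=> H; rewrite leNgt; apply/negP => v0.
  have [h h0 sh] := strict_shift sa.
  suff : complex.Im v < 0 by rewrite ltNge ltW.
  (* Here v a + x = v (a - h e) + i (h Im v) e + ((h Re v) e + x), and h Im v > 0. *)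
  apply: (strict_lower (x := (complex.Re v * h) *: e + x) sh (mulr_gt0 v0 h0)).
  rewrite -[RHS]H.
  congr mmap; apply/funext => i.
  rewrite {1 4}(complexE v) !(iotaD, iotaN, iotaZ) !rmorphM.
  by ring.
move=> H; apply/eqP; rewrite eq_le pos //=.
(* The conjugate of a zero is a zero, as P, a and x are real, so the same bound applies to both. *)
have := pos (conjc w); rewrite (_ : complex.Im (conjc w) = - complex.Im w); last by case: (w).
rewrite oppr_le0; apply.
rewrite -[RHS]conjc0 -[in RHS]H -mmap_conjc; congr mmap; apply/funext => i.
by rewrite rmorphD rmorphM; congr (_ * _ + _); exact/esym/conjc_real.
Qed.

Let cone_strict a : hyperbolicity_cone f e a -> f a != 0 -> strict a.
Proof.
move=> ca a0 t H; have := ca t; rewrite /root (line_polyE _ _ _ homf) H eqxx.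
rewrite le_eqVlt => /(_ isT)/predU1P[t0|//].
by move: H; rewrite -t0 scale0r add0r => /eqP; rewrite (homogeneousN_eq0 homf) (negbTE a0).
Qed.

Lemma garding_real_rooted_mpoly a x :
  hyperbolicity_cone f e a -> f a != 0 -> real_rooted (line_poly f a (- x)).
Proof.
move=> ca a0 w; rewrite /root line_poly_complex => /eqP.
exact/strict_real/cone_strict.
Qed.

(** Write x + t a = y + t b with b = a - h e still [strict]. Along the segment from e to y, the
    zeros z of f(u - i z b), for u on the segment, stay in the lower half-plane; a zero of f at y +
    t b would give z = i t at the end. *)
Lemma garding_cone_mpoly a x t : hyperbolicity_cone f e a -> f a != 0 ->
  hyperbolicity_cone f e x -> 0 < t -> f (x + t *: a) != 0.
Proof.
move=> ca a0 cx t0; have [h h0 sb] := strict_shift (cone_strict ca a0).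
set b := a - h *: e in sb; have b0 := strict_neq0 sb.
have seg (c s : R) : 0 < c -> 0 <= s -> f (c *: e + s *: x) != 0.
  move=> c_gt0; rewrite le_eqVlt => /predU1P[<-|s0].
    by rewrite scale0r addr0 (homogeneousZ_eq0 homf) // gt_eqF.
  apply/eqP => H; have := cx (- (c / s)).
  rewrite /root (line_polyE _ _ _ homf) -(homogeneousZ_eq0 homf (t := - s)); last first.
    by rewrite oppr_eq0 gt_eqF.
  rewrite (_ : - s *: _ = c *: e + s *: x); last first.
    by rewrite scalerDr scalerA mulrNN mulrC divfK ?gt_eqF // scalerN scaleNr opprK.
  rewrite H eqxx.
  by rewrite leNgt oppr_lt0 divr_gt0 // => /(_ isT).
(* Moving t h e from t a to x makes every point of the segment from e to y of the form c e + s x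
   with c > 0, where [seg] applies. *)
pose y := x + (t * h) *: e.
have -> : x + t *: a = y + t *: b.
  by rewrite /y /b scalerBr scalerA addrACA subrr addr0.
have i0 : 'i%C != 0 :> C by rewrite eq_complex /= oner_eq0 andbF.
have Im_i z : complex.Im (- 'i%C * z : C) = - complex.Re z.
  by case: z => u v /=; rewrite oppr0 mul0r add0r mulN1r.
have lower z : FC (fun i => z * (- 'i%C * iota b i) + (iota e i + iota (y - e) i)) = 0 ->
    complex.Im z < 0.
  apply: (@mmap_lower_half_plane R _ d P homP).
  - apply/eqP => /complexZ_eq0; rewrite oppr_eq0 => /(_ i0)/eqP.
    by rewrite FC_eq0 (negbTE b0).
  - move=> s u /andP[s0 s1]; apply/eqP => H.
    have : complex.Im (- 'i%C * toC u) = 0.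
      apply: (strict_real (x := e + s *: (y - e)) sb).
      rewrite -[RHS]H; congr mmap; apply/funext => i.
      by rewrite !(iotaD, iotaN, iotaZ); ring.
    rewrite Im_i /= => /eqP; rewrite oppr_eq0 => /eqP u0.
    have : f ((1 - s + s * (t * h)) *: e + s *: x) == 0.
      rewrite -FC_eq0 -[X in _ == X]H; apply/eqP; congr mmap; apply/funext => i.
      rewrite u0 /y !(iotaD, iotaN, iotaZ).
      by rewrite !(rmorphD, rmorphB, rmorphM, rmorph1, rmorph0) /=; ring.
    apply/negP/seg => //; have th : 0 < t * h by rewrite mulr_gt0.
    by have := mulr_ge0 s0 (ltW th); move: s0; rewrite le_eqVlt => /predU1P[<-|]; [lra|nra].
  - move=> w H; pose v := - 'i%C * w.
    have vE : FC (fun i => v * iota b i + iota e i) = 0.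
      by rewrite -[RHS]H; congr mmap; apply/funext => i; rewrite /v; ring.
    have := strict_real sb vE; rewrite Im_i => /eqP; rewrite oppr_eq0 => /eqP rw.
    have {}vE : f (complex.Im w *: b + e) = 0.
      apply/eqP; rewrite -FC_eq0 -[X in _ == X]vE; apply/eqP.
      congr mmap; apply/funext => i; rewrite iotaD iotaZ; congr (_ * _ + _).
      apply/eqP; rewrite /v; move: rw; case: (w) => p q /= ->.
      by rewrite eq_complex /=; apply/andP; split; apply/eqP; ring.
    have w0 : complex.Im w != 0.
      by apply: contra fe0 => /eqP w0; rewrite -vE w0 scale0r add0r.
    (* By homogeneity, - 1 / Im w is a root of t |-> f(t e - b), hence positive. *)
    have : 0 < - (complex.Im w)^-1; last by rewrite oppr_gt0 invr_lt0.
    apply: sb; apply/eqP; rewrite -(homogeneousZ_eq0 homf (t := - complex.Im w)) ?oppr_eq0 //.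
    by rewrite scalerBr scalerA mulrNN divff // scale1r scaleNr opprK addrC vE.
apply/eqP => H.
suff /lower : FC (fun i => toC t * 'i%C * (- 'i%C * iota b i) +
    (iota e i + iota (y - e) i)) = 0.
  by rewrite /= mul0r mulr1 addr0 lt_gtF.
move/eqP: H; rewrite -FC_eq0 => /eqP H; rewrite -[RHS]H.
congr mmap; apply/funext => i; rewrite !(iotaD, iotaN, iotaZ).
have ii (z z' : C) : z * 'i%C * (- 'i%C * z') = z * z'.
  rewrite (_ : _ * _ * (_ * _) = - ('i%C * 'i%C) * (z * z')); last by ring.
  by rewrite -expr2 sqr_i opprK mul1r.
by rewrite ii; ring.
Qed.

End Garding.

(** * Directional derivatives *)

Section RealRootedDerivative.
Variable R : realType.
Local Notation toC := (real_complex R).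
Implicit Types (r : {poly R}) (s : seq R).

Lemma Im_inv (w : R[i]) :
  complex.Im w^-1 = - complex.Im w / (complex.Re w ^+ 2 + complex.Im w ^+ 2).
Proof. by case: w => x y /=; rewrite mulNr. Qed.

(* Gauss-Lucas: off the real axis, the imaginary part of the logarithmic
   derivative has the sign opposite to that of [Im w]. *)
Lemma log_deriv_prod s (w : R[i]) : complex.Im w != 0 ->
  let q := \prod_(t <- s) ('X - (toC t)%:P) in
  exists S, q^`().[w] = q.[w] * S /\
    (if s is [::] then S = 0 else complex.Im S * complex.Im w < 0).
Proof.
move=> w0 /=; elim: s => [|t s [S [qS SP]]].
  by exists 0; rewrite big_nil derivC horner0 mulr0.
have Imwt : complex.Im (w - toC t) = complex.Im w by rewrite raddfB /= subr0.
have wt0 : w - toC t != 0.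
  by apply: contra w0 => /eqP w_t; rewrite -Imwt w_t.
exists ((w - toC t)^-1 + S); split.
  rewrite big_cons derivM derivXsubC !hornerE qS.
  by field.
rewrite raddfD mulrDl /= Im_inv Imwt.
set D := _ ^+ 2 + _; have D0 : 0 < D.
  by rewrite ltr_wpDl ?sqr_ge0 // exprn_even_gt0.
have neg : - complex.Im w / D * complex.Im w < 0.
  by rewrite mulrAC mulNr -expr2 mulNr oppr_lt0 divr_gt0 // exprn_even_gt0.
have : complex.Im S * complex.Im w <= 0.
  by case: (s) SP => [->|_ _ /ltW //]; rewrite mul0r.
by move=> S0; rewrite ltr_wnDr.
Qed.

Lemma real_rooted_deriv r : r^`() != 0 -> real_rooted r -> real_rooted r^`().
Proof.
move=> r'0 /real_rooted_split[s rE] w; apply: contraTeq => w0.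
have [S [qS SP]] := log_deriv_prod s w0.
have l0 : toC (lead_coef r) != 0.
  rewrite fmorph_eq0 lead_coef_eq0; apply: contra r'0 => /eqP ->.
  by rewrite deriv0.
have mapE : map_poly toC r = toC (lead_coef r) *: \prod_(t <- s) ('X - (toC t)%:P).
  rewrite {1}rE map_polyZ rmorph_prod; congr (_ *: _); apply: eq_bigr => t _.
  by rewrite rmorphB /= map_polyX map_polyC.
rewrite /root -deriv_map mapE derivZ hornerZ mulf_eq0 (negbTE l0) orFb qS mulf_eq0 negb_or.
apply/andP; split.
  rewrite horner_prod prodf_seq_neq0; apply/allP => t _ /=.
  rewrite hornerXsubC; apply: contra w0 => /eqP/(congr1 (@complex.Im R)).
  by rewrite raddfB /= subr0 => ->.
(* Without roots r is constant, which its nonzero derivative excludes; otherwise S has a nonzero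
   imaginary part. *)
case: s rE SP {qS mapE} => [rE _|t s _ lt0]; last first.
  by apply/eqP => S0; move: lt0; rewrite S0 mul0r ltxx.
by move: r'0; rewrite rE big_nil derivZ derivC scaler0 eqxx.
Qed.

Lemma real_rooted_derivn r k : r^`(k) != 0 -> real_rooted r -> real_rooted r^`(k).
Proof.
move=> rk0 rr; elim: k rk0 => [|k IH]; first by rewrite derivn0.
rewrite derivnS => rk0; apply: real_rooted_deriv => //; apply: IH.
by apply: contra rk0 => /eqP ->; rewrite deriv0.
Qed.

End RealRootedDerivative.

Section DirectionalDerivative.
Variables (R : realType) (V : vectType R) (d : nat) (f : V -> R) (e : V).
Hypothesis homf : homogeneous_polynomial d f.
Implicit Types (k : nat) (x : V).

Lemma dirderivE k x : dirderiv k e f x = (line_poly f e x)`_k *+ k`!.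
Proof. by rewrite /dirderiv horner_coef0 coef_derivn addn0 ffactnn. Qed.

Lemma dirderiv_eq0 k x : (dirderiv k e f x == 0) = ((line_poly f e x)`_k == 0).
Proof. by rewrite dirderivE mulrn_eq0 eqn0Ngt fact_gt0. Qed.

Lemma line_poly_dirderiv k x :
  line_poly (dirderiv k e f) e x = (line_poly f e x)^`(k).
Proof.
apply: line_polyP => t; rewrite /dirderiv.
have -> : line_poly f e (t *: e + x) = line_poly f e x \Po ('X + t%:P).
  apply: line_polyP => s; rewrite horner_comp !hornerE (line_polyE _ _ _ homf).
  by rewrite scalerDl.
(* Differentiation commutes with translation of the variable. *)
suff -> (p : {poly R}) : (p \Po ('X + t%:P))^`(k) = p^`(k) \Po ('X + t%:P).
  by rewrite horner_comp !hornerE.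
elim: k => [|k IH]; first by rewrite !derivn0.
by rewrite !derivnS IH deriv_comp derivD derivX derivC addr0 mulr1.
Qed.

(** Expand P(X e + x) with the coordinates of x as indeterminates: the coefficient of X^k is
    homogeneous of degree d - k in x. *)
Lemma dirderiv_homogeneous k : (k <= d)%N ->
  homogeneous_polynomial (d - k) (dirderiv k e f).
Proof.
move=> kd; have [P /dhomogP homP fP] := homf.
pose N := \dim {:V}; pose c x i := coord (vbasis {:V}) i x.
pose T : {poly {mpoly R[N]}} :=
  line_mmap (@mpolyC N R) (fun i => (c e i)%:MP) (fun i => 'X_i) P.
have TE x : line_poly f e x = map_poly (meval (c x)) T.
  apply: line_polyP => t; rewrite fP /T /line_mmap.
  rewrite (rmorph_mmap _ (map_poly (meval (c x)))) [in LHS]/mmap horner_sum.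
  rewrite /meval /mmap; apply: eq_bigr => m _; rewrite hornerM /=.
  rewrite map_polyC hornerC /= mevalC; congr (_ * _).
  rewrite /mmap1 horner_prod; apply: eq_bigr => i _.
  rewrite horner_exp /= rmorphD /= map_polyZ map_polyX map_polyC /= mevalC mevalXU.
  by rewrite !hornerE linearP mulrC.
exists (T`_k *+ k`!); last first.
  by move=> x; rewrite dirderivE TE coef_map mevalMn.
(* The second clause of [K] makes up for truncated subtraction, where j - i is 0 if i > j. *)
apply: rpredMn; pose K j (q : {poly {mpoly R[N]}}) :=
  forall i, q`_i \is (j - i).-homog /\ ((j < i)%N -> q`_i = 0).
suff : K d T by move=> /(_ k)[].
have K1 : K 0 1.
  by move=> i; rewrite coefC; case: i => [|i]; split=> //; rewrite ?dhomog1 ?rpred0.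
have KM j1 q1 j2 q2 : K j1 q1 -> K j2 q2 -> K (j1 + j2)%N (q1 * q2).
  move=> H1 H2 i; rewrite coefM; split; last first.
    move=> lt_i; apply: big1 => l _; have [/(H1 l).2 ->|le_l] := ltnP j1 l.
      by rewrite mul0r.
    by rewrite (H2 (i - l)%N).2 ?mulr0 // ltn_subRL (leq_ltn_trans _ lt_i) // leq_add2r.
  apply: rpred_sum => l _.
  have [lt_l|le_l] := ltnP j1 l; first by rewrite (H1 l).2 // mul0r rpred0.
  have [lt_il|le_il] := ltnP j2 (i - l); first by rewrite (H2 _).2 // mulr0 rpred0.
  have -> : (j1 + j2 - i = (j1 - l) + (j2 - (i - l)))%N.
    by have := ltn_ord l; lia.
  by apply: dhomogM; [exact: (H1 _).1 | exact: (H2 _).1].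
have KX i j : K j ((((c e i)%:MP *: 'X + ('X_i)%:P) : {poly {mpoly R[N]}}) ^+ j).
  elim: j => [|j IH]; first by rewrite expr0.
  rewrite exprS -add1n; apply: KM IH => -[|[|l]]; rewrite coefD coefZ coefX coefC /=.
  - by rewrite mulr0 add0r subn0 dhomogX; split=> //; apply/eqP/mdeg1.
  - rewrite mulr1 addr0; split=> //; rewrite -alg_mpolyC; apply: dhomogZ; exact: dhomog1.
  - by rewrite mulr0 addr0 rpred0.
rewrite /T /line_mmap /mmap big_seq.
apply: (big_ind (K d)) => [i|q1 q2 H1 H2 i|m mP].
- by rewrite coef0 rpred0.
- rewrite coefD; split=> [|ji]; first by rewrite rpredD ?(H1 i).1 ?(H2 i).1.
  by rewrite (H1 i).2 // (H2 i).2 // addr0.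
rewrite -[d]add0n; apply: (KM) => [i|].
  rewrite /= coefC; case: i => [|i]; split=> //; rewrite ?rpred0 //.
  by rewrite -alg_mpolyC; apply: dhomogZ; exact: dhomog1.
rewrite -(homP _ mP) /= mdegE /mmap1.
by apply: (big_ind2 K) => [|j1 q1 j2 q2 H1 H2|i _]; [|exact: KM|exact: KX].
Qed.

End DirectionalDerivative.

(** * Hyperbolicity cones and multiplicities *)

Section Hyperbolic.
Variables (R : realType) (V : vectType R).
Implicit Types (f : V -> R) (e a x : V) (d k : nat).

Lemma garding_real_rooted f e a x : hyperbolic f e ->
  hyperbolicity_cone f e a -> f a != 0 -> real_rooted (line_poly f a (- x)).
Proof.
move=> [[d [P homP fP]] fe rr].
by apply: (garding_real_rooted_mpoly homP fP) => //; rewrite gt_eqF.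
Qed.

Lemma garding_cone f e a x t : hyperbolic f e -> hyperbolicity_cone f e a ->
  f a != 0 -> hyperbolicity_cone f e x -> 0 < t -> f (x + t *: a) != 0.
Proof.
move=> [[d [P homP fP]] fe rr].
by apply: (garding_cone_mpoly homP fP) => //; rewrite gt_eqF.
Qed.

(** The roots of f(t e + x) are opposite to those of f(t e - x), and its leading coefficient f(e) is
    positive. If they are all nonpositive, expanding the linear factors gives nonnegative
    coefficients; conversely, such coefficients exclude a positive root. *)
Lemma hyperbolicity_coneP f e x d : hyperbolic f e -> homogeneous_polynomial d f ->
  hyperbolicity_cone f e x <-> forall j, 0 <= (line_poly f e x)`_j.
Proof.
move=> [_ fe0 rr] homf; have [sr rd] := line_poly_size_top homf e x.
set r := line_poly f e x in sr rd.
have rE t : r.[t] = f (t *: e + x) by rewrite (line_polyE _ _ _ homf).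
have rN t : f (t *: e - x) = 0 <-> root r (- t).
  rewrite /root rE (_ : - t *: e + x = - (t *: e - x)); last by rewrite opprB scaleNr addrC.
  by rewrite (homogeneousN_eq0 homf); split=> /eqP.
have lr : lead_coef r = f e.
  rewrite -rd lead_coefE; congr nth; apply/eqP; rewrite eqn_leq; apply/andP; split.
    by rewrite -subn1 leq_subLR add1n.
  rewrite -ltnS (leq_trans _ (leqSpred _)) // ltnNge; apply/negP => /leq_sizeP/(_ d (leqnn d)).
  by rewrite rd => fe; rewrite fe ltxx in fe0.
split=> [cx|cr t]; last first.
  rewrite /root (line_polyE _ _ _ homf) => /eqP/rN; rewrite leNgt => rt; apply/negP => t0.
  move: rt; rewrite /root horner_coef; apply/negP; rewrite gt_eqF //.
  have dr : (d < size r)%N.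
    rewrite ltnNge; apply/negP => /leq_sizeP/(_ d (leqnn d)).
    by rewrite rd => fe; rewrite fe ltxx in fe0.
  rewrite (bigD1 (Ordinal dr)) //= ltr_wpDr //; last first.
    by rewrite rd mulr_gt0 // exprn_gt0 // oppr_gt0.
  by apply: sumr_ge0 => j _; rewrite mulr_ge0 // exprn_ge0 // oppr_ge0 ltW.
have [s sE] : exists s, r = lead_coef r *: \prod_(t <- s) ('X - t%:P).
  by apply: real_rooted_split; rewrite /r -[x]opprK.
have s0 t : t \in s -> t <= 0.
  move=> ts; rewrite -oppr_ge0; apply: cx; rewrite /root (line_polyE _ _ _ homf).
  apply/eqP/rN; rewrite opprK sE rootZ ?root_prod_XsubC //.
  by rewrite lr gt_eqF.
suff : r \is a polyOver Num.nneg by move=> /polyOverP rp j; have := rp j; rewrite nnegrE.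
rewrite sE lr polyOverZ ?nnegrE ?ltW //.
rewrite big_seq; apply: rpred_prod => t /s0 t0.
by rewrite -rmorphN rpredD ?polyOverX // polyOverC nnegrE oppr_ge0.
Qed.

Lemma dirderiv_hyperbolic f e d k : hyperbolic f e -> homogeneous_polynomial d f ->
  (k <= d)%N -> hyperbolic (dirderiv k e f) e.
Proof.
move=> [_ fe0 rr] homf kd; have homfk := dirderiv_homogeneous e homf kd.
have top x : ((line_poly f e x)^`(k))`_(d - k) = dirderiv k e f e.
  by have [_] := line_poly_size_top homfk e x; rewrite (line_poly_dirderiv e homf).
have pos : 0 < dirderiv k e f e.
  rewrite -(top 0) coef_derivn subnKC // (line_poly_size_top homf e 0).2.
  by rewrite pmulrn_lgt0 // ffact_gt0.
split=> // [|x]; first by exists (d - k)%N.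
rewrite (line_poly_dirderiv e homf); apply: real_rooted_derivn => //.
by apply: contraTneq pos => r0; rewrite -(top (- x)) r0 coef0 ltxx.
Qed.

(** Differentiating k times drops the coefficients of index below k and multiplies the others by
    positive integers. *)
Lemma dirderiv_coneP f e d k x : hyperbolic f e -> homogeneous_polynomial d f -> (k <= d)%N ->
  hyperbolicity_cone (dirderiv k e f) e x <->
  forall j, (k <= j)%N -> 0 <= (line_poly f e x)`_j.
Proof.
move=> hypf homf kd.
rewrite (hyperbolicity_coneP _ (dirderiv_hyperbolic hypf homf kd)
  (dirderiv_homogeneous e homf kd)).
rewrite (line_poly_dirderiv e homf).
have E j : (0 <= (line_poly f e x)^`(k)`_j) = (0 <= (line_poly f e x)`_(k + j)).
  by rewrite coef_derivn pmulrn_lge0 // ffact_gt0 leq_addr.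
split=> H j; first by move=> kj; have := H (j - k)%N; rewrite E subnKC.
by rewrite E H ?leq_addr.
Qed.

Lemma mup0_coef (p : {poly R}) : p != 0 ->
  (forall j, (j < mup 0 p)%N -> p`_j = 0) /\ p`_(mup 0 p) != 0.
Proof.
move=> p0; have := mup_geq 0 (mup 0 p) p0; rewrite leqnn subr0 => /esym/dvdpP[q qE].
set m := mup 0 p in qE *; split=> [j jm|]; first by rewrite qE coefMXn jm.
apply/negP => pm; have : root q 0.
  by rewrite /root horner_coef0; move: pm; rewrite {1}qE coefMXn ltnn subnn.
move=> /factor_theorem[u uE]; have := mup_geq 0 m.+1 p0.
by rewrite ltnn => /esym/negP; apply; rewrite qE uE subr0 -mulrA -exprS dvdp_mull.
Qed.

Lemma multiplicity_coef f e d z : homogeneous_polynomial d f -> f e != 0 ->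
  [/\ (multiplicity f e z <= d)%N,
      forall j, (j < multiplicity f e z)%N -> (line_poly f e z)`_j = 0
    & (line_poly f e z)`_(multiplicity f e z) != 0].
Proof.
move=> homf fe0; have [_ top] := line_poly_size_top homf e (- z).
have p0 : line_poly f e (- z) != 0.
  by apply: contra fe0 => /eqP p0; rewrite -top p0 coef0.
have [lo hi] := mup0_coef p0.
have md : (multiplicity f e z <= d)%N.
  by rewrite leqNgt; apply/negP => /lo; rewrite top => /eqP; rewrite (negbTE fe0).
(* [multiplicity] looks at the line through -z. Up to j!, the coefficients are values of homogeneous
   derivatives, so they vanish at z and -z simultaneously. *)
have sym j : (j <= d)%N -> ((line_poly f e z)`_j == 0) = ((line_poly f e (- z))`_j == 0).
  by move=> jd; rewrite -!dirderiv_eq0 (homogeneousN_eq0 (dirderiv_homogeneous e homf jd)).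
split=> // [j jm|]; last by rewrite sym.
by apply/eqP; rewrite sym ?lo // (leq_trans (ltnW jm)).
Qed.

End Hyperbolic.

(** * Faces *)

Section Restriction.
Variables (R : realType) (V : vectType R) (L : {vspace V}) (f : V -> R).

Lemma restriction_homogeneous d : homogeneous_polynomial d f ->
  homogeneous_polynomial d (restriction L f).
Proof.
move=> [P homP fP]; pose b := vbasis {:subvs_of L}.
pose lq := [tuple \sum_(j < \dim {:subvs_of L})
    coord (vbasis {:V}) i (vsval b`_j) *: 'X_j | i < \dim {:V}]
  : _.-tuple {mpoly R[\dim {:subvs_of L}]}.
exists (P \mPo lq).
  apply: comp_mpoly_dhomog => // i; rewrite tnth_mktuple.
  by apply: rpred_sum => j _; apply: dhomogZ; rewrite dhomogX; apply/eqP/mdeg1.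
move=> x; rewrite /restriction /= fP comp_mpoly_meval; apply: meval_eq => i.
rewrite tnth_mktuple raddf_sum /= {1}(coord_vbasis (memvf x)) !linear_sum /=.
by apply: eq_bigr => j _; rewrite mevalZ mevalXU !linearZ /= mulrC.
Qed.

Lemma line_poly_restriction d a b : homogeneous_polynomial d f ->
  line_poly (restriction L f) a b = line_poly f (vsval a) (vsval b).
Proof.
move=> homf; apply: line_polyP => t.
by rewrite (line_polyE _ _ _ homf) -[RHS]/(f (vsval (t *: a + b))) linearP.
Qed.

End Restriction.

(** * Spans and relative interiors of faces *)

Section Face.
Variables (R : realType) (n : nat).
Implicit Types (A C F : set 'rV[R]_n) (v x z : 'rV[R]_n).

(** Being affine and containing 0, A is closed under linear combinations. A subspace of maximal
    dimension inside A contains F, since a missing point of F could be adjoined to it. *)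
Lemma affine_set_span A F v : affine_set A -> A 0 -> F `<=` A ->
  v \in linear_span F -> A v.
Proof.
move=> affA A0 FA.
have AZ (t : R) x : A x -> A (t *: x).
  by move=> Ax; have := affA _ _ t Ax A0; rewrite scaler0 addr0.
have AD x y : A x -> A y -> A (x + y).
  move=> Ax Ay; have := AZ 2 _ (affA _ _ 2^-1 Ax Ay).
  have half : 1 - 2^-1 = 2^-1 :> R by lra.
  by rewrite half -scalerDr scalerA divff ?pnatr_eq0 // scale1r.
pose inA k := `[< exists2 M : {vspace 'rV[R]_n}, \dim M = k & forall x, x \in M -> A x >].
have ex0 : exists k, inA k.
  exists 0%N; apply/asboolP; exists 0%VS; first exact: dimv0.
  by move=> x; rewrite memv0 => /eqP ->.
have le_dim k : inA k -> (k <= \dim {:'rV[R]_n})%N.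
  by move=> /asboolP[M <- _]; exact/dimvS/subvf.
have [k /asboolP[M dimM MA] kmax] := ex_maxnP ex0 le_dim.
suff /subvP LM : (linear_span F <= M)%VS by move=> /LM/MA.
apply/linear_spanP => x Fx; apply/negPn/negP => xM.
suff : inA (\dim (M + <[x]>)) => [/kmax|].
  rewrite -dimM => le_d; move/negP: xM; apply.
  have /eqP -> : M == (M + <[x]>)%VS by rewrite eqEdim addvSl.
  by rewrite memvE addvSr.
apply/asboolP; exists (M + <[x]>)%VS => // y /memv_addP[u uM [w /vlineP[c ->] ->]].
by apply: AD; [exact: MA | exact/AZ/FA].
Qed.

Lemma relative_interior_line F z v : F 0 -> relative_interior F z ->
  v \in linear_span F ->
  exists2 h : R, 0 < h & forall s, `|s| < h -> F (z + s *: v).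
Proof.
move=> F0 [Fz]; rewrite /within /= => /nbhs_ballP[h /= h0 hF] vF.
(* B bounds all the coordinates of v and is positive even when v = 0. *)
pose B := 1 + \sum_j `|v 0 j|.
have S0 : 0 <= \sum_j `|v 0 j| by apply: sumr_ge0.
have B0 : 0 < B by rewrite ltr_wpDr.
exists (h / B); first by rewrite divr_gt0.
move=> s; rewrite ltr_pdivlMr // => sh; apply: hF.
  split=> // i j; rewrite /ball /= /ball_ /= !mxE opprD addrA subrr sub0r normrN.
  rewrite ord1 normrM (le_lt_trans _ sh) // ler_wpM2l // /B (bigD1 j) //=.
  by rewrite addrCA lerDl addr_ge0 // sumr_ge0.
move=> A [affA FA]; have A0 := FA _ F0.
have Av := affine_set_span affA A0 FA vF.
(* The point z + s v is the midpoint of 2 z and 2 s v. *)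
have := affA _ _ 2^-1 (affA _ _ 2 (FA _ Fz) A0) (affA _ _ (2 * s) Av A0).
have half : 1 - 2^-1 = 2^-1 :> R by lra.
by rewrite half !scaler0 !addr0 !scalerA mulrA mulVf ?pnatr_eq0 // scale1r mul1r.
Qed.

(** The point z of the face is the midpoint of 2 z and 0. *)
Lemma face_cone C F z : C 0 -> C (2 *: z) -> face C F -> F z -> F 0.
Proof.
move=> C0 C2z [_ _ _ Fface] Fz.
have [||_ //] := Fface _ _ 2^-1 C2z C0.
  by rewrite invr_gt0 invf_lt1 ?ltr1n ?ltr0n.
by rewrite scalerA mulVf ?pnatr_eq0 // scale1r scaler0 addr0.
Qed.

End Face.

(** * Faces as hyperbolicity cones of directional derivatives *)

Theorem corollary3p4 (R : realType) (n : nat) (p : 'rV[R]_n -> R)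
    (e z : 'rV[R]_n) (F : set 'rV[R]_n) :
  hyperbolic p e ->
  face (hyperbolicity_cone p e) F ->
  relative_interior F z ->
  let L := linear_span F in
  let m := multiplicity p e z in
  let q := restriction L (dirderiv m e p) in
  let zL := vsproj L z in
  hyperbolic q zL /\ F = [set vsval x | x in hyperbolicity_cone q zL].
Proof.
move=> hypp faceF relz L m q zL.
have [[d homp] pe0 _] := hypp; have [_ _ FC Fface] := faceF; have Fz := relz.1.
have [md mlo mhi] := multiplicity_coef z homp (lt0r_neq0 pe0).
rewrite -/m in md mlo mhi.
pose D k := dirderiv k e p.
have hypD k : (k <= d)%N -> hyperbolic (D k) e := dirderiv_hyperbolic hypp homp.
have homD k : (k <= d)%N -> homogeneous_polynomial (d - k) (D k)
  := @dirderiv_homogeneous _ _ _ _ e homp k.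
have coneD k x : (k <= d)%N -> hyperbolicity_cone p e x -> hyperbolicity_cone (D k) e x.
  move=> kd /(hyperbolicity_coneP _ hypp homp) cx.
  by apply/(dirderiv_coneP _ hypp homp kd) => j _.
have FL x : F x -> x \in L by move: x; apply/linear_spanP.
have F0 : F 0.
  apply: (face_cone _ _ faceF Fz) => [t|t].
    rewrite /root (line_polyE _ _ _ homp) subr0 (homogeneousZ homp) mulf_eq0.
    by rewrite (gt_eqF pe0) orbF expf_eq0 => /andP[_ /eqP ->].
  rewrite /root (line_polyE _ _ _ homp) -(homogeneousZ_eq0 homp (t := 2^-1));
    last by rewrite invr_eq0 pnatr_eq0.
  rewrite scalerBr !scalerA mulVf ?pnatr_eq0 // scale1r => H.
  have := FC _ Fz (2^-1 * t); rewrite /root (line_polyE _ _ _ homp) H => /(_ isT).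
  by rewrite pmulr_rge0 // invr_gt0 ltr0n.
have line v : v \in L -> exists2 h : R, 0 < h & forall s, `|s| < h -> F (z + s *: v).
  exact: relative_interior_line.
have loF j y : (j < m)%N -> F y -> D j y = 0.
  move=> jm Fy; have jd : (j <= d)%N := leq_trans (ltnW jm) md.
  apply/eqP/negPn/negP => y0; have [h h0 hF] := line _ (FL _ Fy).
  have h2 : 0 < h / 2 by rewrite divr_gt0.
  have Fz' : F (z + - (h / 2) *: y) by apply: hF; rewrite normrN gtr0_norm //; lra.
  have := garding_cone (hypD _ jd) (coneD _ _ jd (FC _ Fy)) y0 (coneD _ _ jd (FC _ Fz')) h2.
  by rewrite scaleNr addrNK /D dirderiv_eq0 mlo ?eqxx.
have loL j x : (j < m)%N -> x \in L -> D j x = 0.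
  move=> jm xL; have jd : (j <= d)%N := leq_trans (ltnW jm) md.
  have [h h0 hF] := line _ xL.
  (* The polynomial s |-> D j (s x + z) vanishes for all small s, hence identically; its coefficient
     of degree d - j is D j x. *)
  have l0 : line_poly (D j) x z = 0.
    apply/eqP/negPn/negP => l0.
    (* These are more roots than the degree allows; the denominators start at 2 to keep them
       strictly below h. *)
    pose s := [seq h / (k.+2)%:R | k <- iota 0 (size (line_poly (D j) x z))].
    have := @max_poly_roots _ _ s l0; rewrite size_map size_iota ltnn => H.
    suff : false by []; apply: H.
      apply/allP => _ /mapP[k _ ->]; rewrite /root (line_polyE _ _ _ (homD _ jd)).
      apply/eqP/loF => //; rewrite addrC; apply: hF.
      by rewrite gtr0_norm ?divr_gt0 // ltr_pdivrMr // ltr_pMr // ltr1n.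
    rewrite map_inj_uniq ?iota_uniq // => i k /(mulfI (lt0r_neq0 h0))/invr_inj/eqP.
    by rewrite eqr_nat => /eqP[].
  have [_ <-] := line_poly_size_top (homD _ jd) x z.
  by rewrite l0 coef0.
have Dz0 : D m z != 0 by rewrite dirderiv_eq0.
have zcone := coneD _ _ md (FC _ Fz).
have Dz : 0 < D m z.
  rewrite lt_neqAle eq_sym Dz0 /D dirderivE mulrn_wge0 //.
  by move/(hyperbolicity_coneP _ hypp homp): (FC _ Fz).
have zLE : vsval zL = z by rewrite vsprojK ?FL.
have hypz : hyperbolic (D m) z.
  split=> // [|x]; first by exists (d - m)%N; exact: homD.
  exact: garding_real_rooted (hypD _ md) _ _.
have qcone (y : subvs_of L) :
    hyperbolicity_cone q zL y <-> hyperbolicity_cone (D m) z (vsval y).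
  rewrite /hyperbolicity_cone /= (line_poly_restriction _ _ (homD _ md)) zLE linearN.
  by [].
split.
  split; first by exists (d - m)%N; apply: restriction_homogeneous; exact: homD.
    by rewrite /q /restriction /= zLE.
  move=> x; rewrite (line_poly_restriction _ _ (homD _ md)) zLE linearN.
  by case: hypz.
have oppD x s : D m (- s *: z - x) = 0 -> D m (x + s *: z) = 0.
  move=> H; apply/eqP; rewrite -(homogeneousN_eq0 (homD _ md)) opprD addrC -scaleNr.
  exact/eqP.
rewrite eqEsubset; split=> [x Fx|_ [y cy <-]].
  exists (vsproj L x); last by rewrite /= vsprojK ?FL.
  apply/qcone; rewrite vsprojK ?FL // => t.
  rewrite /root (line_polyE _ _ _ (homD _ md)) => /eqP H; rewrite leNgt; apply/negP => t0.
  (* A negative root t would be a zero of D m at x + (- t) z, which Garding's theorem in direction e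
     excludes. *)
  have /oppD/eqP : D m (- (- t) *: z - x) = 0 by rewrite opprK.
  apply/negP; apply: garding_cone (hypD _ md) zcone Dz0 _ _; last by rewrite oppr_gt0.
  exact/coneD/FC.
set x := vsval y; have xL : x \in L := subvsP y.
have /qcone cx := cy; rewrite -/x in cx.
have De0 : D m e != 0 by case: (hypD _ md) => _ /lt0r_neq0.
(* By homogeneity, the roots of t |-> D m (t z - e) are inverses of roots of t |-> D m (t e - z). *)
have econe : hyperbolicity_cone (D m) z e.
  move=> t; rewrite /root (line_polyE _ _ _ (homD _ md)) => /eqP H.
  have t0 : t != 0.
    apply/eqP => t0; move/eqP: H.
    by rewrite t0 scale0r add0r (homogeneousN_eq0 (homD _ md)) (negbTE De0).
  rewrite -invr_ge0; apply: zcone; rewrite /root (line_polyE _ _ _ (homD _ md)).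
  rewrite -(homogeneousZ_eq0 (homD _ md) (t := - t)) ?oppr_eq0 //.
  by rewrite scalerBr scalerA mulNr divff // scaleN1r scaleNr opprK addrC H.
(* Garding's theorem for D m in direction z, applied to e, brings x back to the cone taken in
   direction e. *)
have xD : hyperbolicity_cone (D m) e x.
  move=> t; rewrite /root (line_polyE _ _ _ (homD _ md)) => /eqP H.
  rewrite leNgt; apply/negP => t0.
  have := garding_cone hypz econe De0 cx (t := - t); rewrite oppr_gt0 => /(_ t0).
  by rewrite -(homogeneousN_eq0 (homD _ md)) opprD scaleNr opprK addrC H eqxx.
have xcone : hyperbolicity_cone p e x.
  apply/(hyperbolicity_coneP _ hypp homp) => j; have [jm|mj] := ltnP j m.
    by have /eqP := loL _ _ jm xL; rewrite /D dirderiv_eq0 => /eqP ->.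
  by move/(dirderiv_coneP _ hypp homp md): xD; apply.
(* Prolong the segment from x to z slightly beyond z, inside F. Then z lies strictly between x and a
   point of F, and the face property puts x in F. *)
have [h h0 hF] := line (z - x) (rpredB (FL _ Fz) xL).
pose c := h / 2; have c0 : 0 < c by rewrite divr_gt0.
have Fw : F (z + c *: (z - x)) by apply: hF; rewrite gtr0_norm // /c; lra.
have c1 : 0 < 1 + c by rewrite addr_gt0.
have [] // := Fface x (z + c *: (z - x)) (c / (1 + c)) xcone (FC _ Fw).
  by rewrite divr_gt0 //= ltr_pdivrMr // mul1r ltrDr.
suff -> : (c / (1 + c)) *: x + (1 - c / (1 + c)) *: (z + c *: (z - x)) = z by [].
by apply/rowP => j; rewrite !mxE; field; rewrite gt_eqF.
Qed.
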